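(* Let $n,d,k$ be integers with $1<k<n$ and $d\ge 2$. Then $$\operatorname{reg}\bigl(I_{(n,d,0),k}\bigr)=(n-k)\left\lfloor\frac{d-1}{k}\right\rfloor+d-1 .$$
   Context: $K$ is a field and $S=K[x_1,\dots,x_n]$ is the polynomial ring in $n$ indeterminates with the standard grading. $I_{(n,d,0),k}\subset S$ is the ideal generated by all monomials $u$ of degree $d$ with $|\operatorname{supp}(u)|\le k$, where $\operatorname{supp}(u)=\{i : x_i\mid u\}$. $\operatorname{reg}$ denotes Castelnuovo-Mumford regularity.
   Formalization: The stated value is the regularity of the quotient S/I, not of the ideal I, and is proved for S/I; reg(I) as a module is larger by one (for n=3, k=2, d=2 the ideal is the square of the maximal ideal, with reg(I)=2, while the formula gives 1). *)

(* Defs.v *)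
From mathcomp Require Import all_boot all_order all_algebra.
From mathcomp Require Import mpoly.

Set Implicit Arguments.
Unset Strict Implicit.
Unset Printing Implicit Defensive.

Import GRing.Theory.
Local Open Scope ring_scope.

Definition ideal_generated (R : comNzRingType) (G : R -> Prop) (f : R) : Prop :=
  exists s : seq (R * R),
    (forall c, c \in s -> G c.2) /\ f = \sum_(c <- s) c.1 * c.2.

Definition msupport (n : nat) (u : 'X_{1..n}) : {set 'I_n} :=
  [set i | (0 < u i)%N].

(* I_{(n,d,0),k} *)
Definition bounded_support_ideal (K : fieldType) (n d k : nat) :
    {mpoly K[n]} -> Prop :=
  ideal_generated (fun f => exists u : 'X_{1..n},
    [/\ mdeg u = d, (#|msupport u| <= k)%N & f = 'X_[u]]).

(* Graded free modules F_p = (+)_i S(- shift p i) over S = K[x_1..x_n], with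
   maps ... -> F_1 -> F_0 -> S/J.  Elements of F_p are row vectors, so maps act
   by right multiplication; [aug] lists representatives in S of the images of
   the basis of F_0.  The ranks are finite; they may vanish for large p. *)
Record free_complex (K : fieldType) (n : nat) := FreeComplex {
  rk : nat -> nat;
  shift : forall p, 'I_(rk p) -> nat;
  diff : forall p, 'M[{mpoly K[n]}]_(rk p.+1, rk p);
  aug : 'cV[{mpoly K[n]}]_(rk 0)
}.

(* The first two clauses say that the maps are homogeneous of degree 0; the
   condition on monomials forces an entry to vanish when its degree would be
   negative.  The last clause is minimality: the image of F_(p+1) lies in
   (x_1, ..., x_n) F_p. *)
Record minimal_graded_free_resolution (K : fieldType) (n : nat)
    (J : {mpoly K[n]} -> Prop) (F : free_complex K n) : Prop := {
  diff_homog : forall p i j (m : 'X_{1..n}),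
    m \in msupp (diff F p i j) -> (mdeg m + shift j)%N = shift i;
  aug_homog : forall i (m : 'X_{1..n}),
    m \in msupp (aug F i 0) -> mdeg m = shift i;
  aug_surjective : forall f : {mpoly K[n]},
    exists v : 'rV_(rk F 0), J (f - (v *m aug F) 0 0);
  exact_at_0 : forall v : 'rV_(rk F 0),
    J ((v *m aug F) 0 0) <-> exists w, v = w *m diff F 0;
  exact_at_succ : forall p (v : 'rV_(rk F p.+1)),
    v *m diff F p = 0 <-> exists w, v = w *m diff F p.+1;
  resolution_minimal : forall p i j, (diff F p i j)@_0%MM = 0
}.

(* reg(S/J) = r, where reg(S/J) = max {a - p : beta_{p,a}(S/J) <> 0} and
   beta_{p,a} is the number of summands S(-a) of F_p.  The minimal graded free
   resolution is unique up to isomorphism, so r does not depend on F.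
   For an ideal, the regularity read off from the resolution of S/J differs
   from that of J as a module: reg(J) = reg(S/J) + 1 when 0 <> J <> S. *)
Definition quotient_regularity (K : fieldType) (n : nat)
    (J : {mpoly K[n]} -> Prop) (r : nat) : Prop :=
  exists2 F : free_complex K n, minimal_graded_free_resolution J F &
    (forall p (i : 'I_(rk F p)), (shift i <= r + p)%N) /\
    (exists p (i : 'I_(rk F p)), shift i = (r + p)%N).

(* Main.v *)
Require Import Defs.
From mathcomp Require Import all_boot all_order all_algebra.
From mathcomp Require Import mpoly ring zify.

(** Write [S] for the polynomial ring and [J] for the ideal.  A monomial [m]
    lies outside [J] exactly when every set of at most [k] of its exponents has
    sum [< d] ([bounded_support_idealE]).  In such an [m] the [k] largest
    exponents add up to at most [d - 1], so each of the other [n - k] is at most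
    [(d - 1) %/ k]; hence [S/J] is nonzero only up to degree
    [(n - k) * ((d - 1) %/ k) + (d - 1)], and the monomial with all exponents
    [(d - 1) %/ k] but one, which also gets the remainder of the division,
    reaches this degree ([small_sums_deg], [small_sums_top]).  It remains to see
    that the regularity of a finite-dimensional monomial quotient [A = S/J] is
    its largest nonzero degree [r] ([artinian_monomial_regularity]).

    Let [y_i] be multiplication by the i-th variable on [A].  The Koszul complex
    of the commuting operators [x_i - y_i] on the free module [S (x) A] is a
    finite graded free resolution of [A] ([koszul_resolution]).  Its basis
    elements are [e_T (x) y^a], with [T] a set of variables and [y^a] a standard
    monomial, that is, one outside [J]; the homological degree is [#|T|] and the
    internal degree [#|T| + mdeg a <= r + #|T|].  Exactness comes from the
    classical Koszul complex on the [x_i]: its contracting homotopy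
    ([koszul_homotopy]) corrects a cycle in one degree of [a] after the other,
    since the [y_i] only raise that degree.

    This resolution is not minimal, but every entry of a differential with
    nonzero constant term is a nonzero scalar, and Gaussian elimination on it
    removes two basis elements of the same internal degree in adjacent
    homological degrees and leaves a resolution ([elimination]).  This ends with
    a minimal resolution.  The bound [r + p] on the internal degrees in
    homological degree [p] is inherited, and a basis element of internal degree
    [r + n] in homological degree [n] cannot be cancelled: a partner would have
    homological degree [n - 1], where all internal degrees are below [r + n], or
    [n + 1], where there is nothing.  So the bound [r] is attained at [p = n]. *)

Set Implicit Arguments.
Unset Strict Implicit.
Unset Printing Implicit Defensive.

Import GRing.Theory.
Local Open Scope ring_scope.

(** * Cancelling a graded free resolution down to a minimal one *)

Section BasedResolution.
Variables (K : fieldType) (n : nat) (J : {mpoly K[n]} -> Prop).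
Local Notation S := {mpoly K[n]}.
Hypothesis J_sub : forall f g, J f -> J g -> J (f - g).
Hypothesis J_mul : forall f g, J g -> J (f * g).

Variables (I : finType) (hd sh : I -> nat) (e : I -> S).
Implicit Types (B : {set I}) (D : I -> I -> S) (v w : I -> S).

(** Matrices indexed by [I] of which only the rows and columns in [B] count: with
    this encoding a basis element is dropped by shrinking [B], and the index
    type stays the same.  Vectors are row vectors. *)
Definition bd_on B D v (c : I) : S := \sum_(b in B) v b * D b c.

Definition aug_on B v : S := \sum_(b in B) v b * e b.

(** A graded free resolution of [S/J] with all free modules put into a single
    one: [hd] and [sh] are the homological and the internal degree of a basis
    element, [D] is the sum of all differentials and [e] the augmentation.
    Because [D] lowers [hd] by one, exactness of the total module is exactness
    in every homological degree, so no statement has to mention a degree. *)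
Record based_resolution B D : Prop := BasedResolution {
  based_hd : forall b c, b \in B -> c \in B -> D b c != 0 -> hd b = (hd c).+1;
  based_sh : forall b c m, b \in B -> c \in B -> m \in msupp (D b c) ->
    (mdeg m + sh c)%N = sh b;
  based_aug_hd : forall b, b \in B -> e b != 0 -> hd b = 0%N;
  based_aug_sh : forall b m, b \in B -> m \in msupp (e b) -> mdeg m = sh b;
  based_onto : forall f, exists v, J (f - aug_on B v);
  based_complex : forall w c, c \in B -> bd_on B D (bd_on B D w) c = 0;
  based_aug_complex : forall w, J (aug_on B (bd_on B D w));
  based_exact : forall v, {in B, forall c, bd_on B D v c = 0} ->
    J (aug_on B v) -> exists w, {in B, v =1 bd_on B D w}
}.

Lemma J_add f g : J f -> J g -> J (f + g).
Proof.
move=> Jf Jg; rewrite -[g]opprK; apply: J_sub => //.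
by rewrite -mulN1r; apply: J_mul.
Qed.

Lemma eq_bd_on B D v w c : {in B, v =1 w} -> bd_on B D v c = bd_on B D w c.
Proof. by move=> vw; apply: eq_bigr => b Bb; rewrite vw. Qed.

Lemma eq_aug_on B v w : {in B, v =1 w} -> aug_on B v = aug_on B w.
Proof. by move=> vw; apply: eq_bigr => b Bb; rewrite vw. Qed.

Lemma bd_onB B D v w c :
  bd_on B D (fun b => v b - w b) c = bd_on B D v c - bd_on B D w c.
Proof. by rewrite -sumrB; apply: eq_bigr => b _; rewrite mulrBl. Qed.

Lemma aug_onB B v w : aug_on B (fun b => v b - w b) = aug_on B v - aug_on B w.
Proof. by rewrite -sumrB; apply: eq_bigr => b _; rewrite mulrBl. Qed.

Lemma bd_on_delta B D b a c : b \in B ->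
  bd_on B D (fun b' => a *+ (b' == b)) c = a * D b c.
Proof.
move=> Bb; rewrite /bd_on (bigD1 b) //= eqxx mulr1n big1 ?addr0 // => i.
by case/andP=> _ /negPf->; rewrite mulr0n mul0r.
Qed.

Section Elimination.
Variables (B : {set I}) (D : I -> I -> S) (b0 c0 : I).
Hypothesis resD : based_resolution B D.
Hypotheses (Bb0 : b0 \in B) (Bc0 : c0 \in B) (unit00 : (D b0 c0)@_0%MM != 0).

Let u := D b0 c0.
Let iu : S := ((D b0 c0)@_0%MM)^-1%:MP.

(** The Schur complement of the entry at [(b0, c0)]. *)
Definition pivoted b c : S := D b c - D b c0 * iu * D b0 c.

Lemma hd_pivot : hd b0 = (hd c0).+1.
Proof.
apply: (based_hd resD) => //; apply: contraNneq unit00 => ->.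
by rewrite mcoeff0.
Qed.

Lemma sh_pivot : sh b0 = sh c0.
Proof.
have := based_sh resD Bb0 Bc0 (m := 0%MM); rewrite mcoeff_msupp unit00 mdeg0.
by move=> /(_ isT) <-.
Qed.

(** By homogeneity an entry with a nonzero constant term joins basis elements of
    equal internal degree and is therefore a scalar. *)
Lemma pivot_const : u = ((D b0 c0)@_0%MM)%:MP.
Proof.
apply/mpolyP => m; rewrite mcoeffC.
have [->|m0] := eqVneq m 0%MM; first by rewrite mulr1.
rewrite mulr0; apply/eqP; rewrite mcoeff_eq0; apply/negP => /(based_sh resD Bb0 Bc0).
rewrite sh_pivot => /eqP; rewrite -{2}[sh c0]add0n eqn_add2r mdeg_eq0.
by rewrite (negPf m0).
Qed.

Lemma pivot_unit : iu * u = 1.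
Proof. by rewrite pivot_const /iu -mpolyCM mulVf // mpolyC1. Qed.

Lemma pivot_neq : c0 != b0.
Proof. by apply/eqP => cb; have := hd_pivot; rewrite cb => /n_Sn. Qed.

Let B' := B :\ b0 :\ c0.

Lemma big_pivot (F : I -> S) :
  \sum_(b in B) F b = F b0 + (F c0 + \sum_(b in B') F b).
Proof.
rewrite (big_setD1 b0) //=; congr (_ + _).
by rewrite (big_setD1 c0) //= !inE pivot_neq.
Qed.

Lemma sub_pivot b : b \in B' -> b \in B.
Proof. by rewrite !inE => /and3P[]. Qed.

Lemma pivot_inB' b : b \in B' -> (b != b0) * (b != c0).
Proof. by rewrite !inE => /and3P[-> ->]. Qed.

Lemma D_hd0 b c : b \in B -> c \in B -> hd b != (hd c).+1 -> D b c = 0.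
Proof.
by move=> Bb Bc; apply: contraNeq => /(based_hd resD Bb Bc) ->.
Qed.

Lemma D_c0c0 : D c0 c0 = 0.
Proof. by apply: D_hd0 => //; apply/eqP => /n_Sn. Qed.

(** The chain map from the smaller complex into the given one: the coordinate at
    [b0] is the one that kills the coordinate of the boundary at [c0]. *)
Definition lift_elim v b : S :=
  if b == b0 then - (\sum_(b' in B') v b' * D b' c0) * iu
  else if b == c0 then 0 else v b.

Lemma lift_elimE v : {in B', lift_elim v =1 v}.
Proof.
by move=> b B'b; rewrite /lift_elim; case: (pivot_inB' B'b) => /negPf-> /negPf->.
Qed.

Lemma lift_b0 v : lift_elim v b0 = - (\sum_(b' in B') v b' * D b' c0) * iu.
Proof. by rewrite /lift_elim eqxx. Qed.

Lemma lift_c0 v : lift_elim v c0 = 0.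
Proof. by rewrite /lift_elim eqxx (negPf pivot_neq). Qed.

Lemma bd_on_lift v c :
  bd_on B D (lift_elim v) c = bd_on B' pivoted v c.
Proof.
rewrite /bd_on big_pivot lift_b0 lift_c0 mul0r add0r addrC.
rewrite (eq_bigr (fun b => v b * D b c)); last by move=> b /lift_elimE->.
rewrite mulNr mulNr -mulrA mulr_suml -sumrB; apply: eq_bigr => b _.
by rewrite /pivoted mulrBr !mulrA.
Qed.

Lemma pivoted_c0 v : bd_on B' pivoted v c0 = 0.
Proof.
rewrite /bd_on big1 // => b _; rewrite /pivoted -mulrA pivot_unit mulr1.
by rewrite subrr mulr0.
Qed.

(** For a cycle of the smaller complex, the boundary of the lift can only have a
    coordinate at [b0].  That coordinate times the pivot is a coordinate of the
    boundary of a boundary, hence zero. *)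
Lemma vanish_b0 v : {in B', forall c, bd_on B' pivoted v c = 0} ->
  {in B, forall c, bd_on B D (lift_elim v) c = 0}.
Proof.
move=> v0.
set y := bd_on B D (lift_elim v) b0.
have y0 : y = 0.
  have := based_complex resD (lift_elim v) Bc0.
  rewrite {1}/bd_on big_pivot bd_on_lift D_c0c0 mulr0 add0r big1 ?addr0.
    by move=> /(congr1 (fun f => f * iu)); rewrite mul0r -mulrA [_ * iu]mulrC
      pivot_unit mulr1 -bd_on_lift.
  by move=> b B'b; rewrite bd_on_lift v0 // mul0r.
move=> c Bc; have [->//|cb0] := eqVneq c b0.
rewrite bd_on_lift; have [->|cc0] := eqVneq c c0; first exact: pivoted_c0.
by apply: v0; rewrite !inE cb0 cc0.
Qed.

(** Both sides agree outside [b0], and the coordinate at [b0] is determined by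
    the vanishing of the boundary at [c0]. *)
Lemma lift_bd_on v : {in B, lift_elim (bd_on B' pivoted v) =1 bd_on B D (lift_elim v)}.
Proof.
move=> b Bb; have [->|bb0] := eqVneq b b0; last first.
  have [->|bc0] := eqVneq b c0; first by rewrite lift_c0 bd_on_lift pivoted_c0.
  by rewrite lift_elimE ?bd_on_lift // !inE bb0 bc0.
rewrite lift_b0.
have := based_complex resD (lift_elim v) Bc0.
rewrite {1}/bd_on big_pivot D_c0c0 mulr0 add0r.
rewrite (eq_bigr (fun b => bd_on B' pivoted v b * D b c0)); last first.
  by move=> b' _; rewrite bd_on_lift.
move/eqP; rewrite addrC addr_eq0 => /eqP->.
by rewrite opprK -mulrA [_ * iu]mulrC pivot_unit mulr1.
Qed.

Lemma aug_on_lift v : aug_on B (lift_elim v) = aug_on B' v.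
Proof.
rewrite /aug_on big_pivot lift_c0 mul0r add0r.
have ->: e b0 = 0.
  by apply/eqP; apply: contraT => /(based_aug_hd resD Bb0); rewrite hd_pivot.
by rewrite mulr0 add0r; apply: eq_bigr => b /lift_elimE ->.
Qed.

(** A vector is changed by a boundary, the multiple of the boundary of [b0] that
    clears its coordinate at [c0]; what is left lies in the smaller complex, up
    to its coordinate at [b0]. *)
Definition clear_c0 v b : S := v b - v c0 * iu * D b0 b.

Lemma clear_c0E v : clear_c0 v c0 = 0.
Proof. by rewrite /clear_c0 -mulrA pivot_unit mulr1 subrr. Qed.

Lemma clear_c0_bd v : {in B, clear_c0 v =1
  fun b => v b - bd_on B D (fun b' => (v c0 * iu) *+ (b' == b0)) b}.
Proof. by move=> b Bb; rewrite bd_on_delta. Qed.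

(** The lift is a chain map that respects the augmentation, so cycles of the
    smaller complex become boundaries of the given one; once the preimage is
    cleared at [c0], it comes from the smaller complex. *)
Lemma elimination : based_resolution B' pivoted.
Proof.
split.
- move=> b c /sub_pivot Bb /sub_pivot Bc; rewrite /pivoted.
  have [->|Dbc _] := eqVneq (D b c) 0; last exact: (based_hd resD).
  rewrite sub0r oppr_eq0 !mulf_eq0 !negb_or -andbA => /and3P[h1 _ h2].
  rewrite (based_hd resD Bb Bc0 h1) -hd_pivot.
  exact: (based_hd resD Bb0 Bc h2).
- move=> b c m /sub_pivot Bb /sub_pivot Bc; rewrite /pivoted.
  move/msuppB_le; rewrite mem_cat => /orP[|]; first exact: (based_sh resD).
  rewrite mulrAC mulrC mul_mpolyC => /msuppZ_le /msuppM_le.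
  case/allpairsP => -[m1 m2] /= [h1 h2 ->].
  have := based_sh resD Bb Bc0 h1; have := based_sh resD Bb0 Bc h2.
  by rewrite sh_pivot mdegD -addnA => -> ->.
- by move=> b /sub_pivot; apply: (based_aug_hd resD).
- by move=> b m /sub_pivot; apply: (based_aug_sh resD).
- move=> f; have [v Jv] := based_onto resD f; exists (clear_c0 v).
  rewrite -aug_on_lift.
  have ->: aug_on B (lift_elim (clear_c0 v)) = aug_on B (clear_c0 v).
    rewrite aug_on_lift /aug_on big_pivot clear_c0E mul0r add0r.
    have ->: e b0 = 0.
      by apply/eqP; apply: contraT => /(based_aug_hd resD Bb0); rewrite hd_pivot.
    by rewrite mulr0 add0r.
  rewrite (eq_aug_on (@clear_c0_bd v)) aug_onB opprB addrA addrAC -[f - _ + _]addrC.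
  rewrite addrC; apply: J_add => //; exact: (based_aug_complex resD).
- move=> w c B'c; rewrite -bd_on_lift (eq_bd_on _ _ (@lift_bd_on w)).
  by apply: (based_complex resD); apply: sub_pivot.
- move=> w; rewrite -aug_on_lift (eq_aug_on (@lift_bd_on w)).
  exact: (based_aug_complex resD).
- move=> v v0 Jv; have := vanish_b0 v0; rewrite -aug_on_lift in Jv.
  move=> /(based_exact resD)/(_ Jv)[w vw]; exists (clear_c0 w) => c B'c.
  have Bc := sub_pivot B'c.
  rewrite -[LHS]lift_elimE // -bd_on_lift.
  (* clearing [w] keeps its boundary, which vanishes at [c0], and this forces
     the coordinate at [b0] to be that of a lift *)
  have eqlift : {in B, lift_elim (clear_c0 w) =1 clear_c0 w}.
    move=> b Bb; have [->|bb0] := eqVneq b b0; last first.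
      have [->|bc0] := eqVneq b c0; first by rewrite lift_c0 clear_c0E.
      by rewrite lift_elimE // !inE bb0 bc0.
    have wc0 : bd_on B D (clear_c0 w) c0 = 0.
      rewrite (eq_bd_on _ _ (@clear_c0_bd w)) bd_onB (based_complex resD) // subr0.
      by rewrite -(vw _ Bc0) lift_c0.
    move: wc0; rewrite lift_b0 /bd_on big_pivot clear_c0E mul0r add0r.
    move/eqP; rewrite addrC addr_eq0 => /eqP->.
    by rewrite opprK -mulrA [_ * iu]mulrC pivot_unit mulr1.
  rewrite (eq_bd_on _ _ eqlift) (eq_bd_on _ _ (@clear_c0_bd w)) bd_onB.
  by rewrite (based_complex resD) // subr0 vw.
Qed.

End Elimination.

(** A basis element of internal degree [r + l] in the last homological degree [l]
    survives every cancellation: it is not [b0], because [c0] would have the same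
    internal degree in homological degree [l - 1], against the bound, and it is
    not [c0], because [b0] would have homological degree [l + 1]. *)
Lemma minimal_based_resolution (l r : nat) B D :
  based_resolution B D ->
  {in B, forall b, hd b <= l}%N -> {in B, forall b, sh b <= r + hd b}%N ->
  (exists2 b, b \in B & hd b = l /\ sh b = r + l)%N ->
  exists B' D', [/\ based_resolution B' D',
    {in B' &, forall b c, ((D' b c)@_0%MM = 0)%R},
    {in B', forall b, sh b <= r + hd b}%N &
    exists2 b, b \in B' & hd b = l /\ sh b = r + l]%N.
Proof.
have [N] := ubnP #|B|; elim: N => // N IHN in B D *.
rewrite ltnS => leBN resD hdB shB [b1 Bb1 [hb1 sb1]].
case: (pickP [pred bc : I * I | [&& bc.1 \in B, bc.2 \in B &
    (D bc.1 bc.2)@_0%MM != 0]]) => [[b0 c0] /= /and3P[Bb0 Bc0 u00]|min]; last first.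
  exists B, D; split=> //; last by exists b1.
  move=> b c Bb Bc; have := min (b, c); rewrite /= Bb Bc /=.
  by move/negbT; rewrite negbK => /eqP.
have hd0 := hd_pivot resD Bb0 Bc0 u00; have sh0 := sh_pivot resD Bb0 Bc0 u00.
have cb0 := pivot_neq resD Bb0 Bc0 u00.
have subB b : b \in B :\ b0 :\ c0 -> b \in B by rewrite !inE => /and3P[].
apply: (IHN _ _ _ (elimination resD Bb0 Bc0 u00)).
- apply: leq_trans leBN; rewrite [#|B|](cardsD1 b0) Bb0 add1n ltnS.
  by apply: subset_leq_card; apply: subD1set.
- by move=> b /subB; apply: hdB.
- by move=> b /subB; apply: shB.
exists b1 => //; rewrite !inE Bb1 andbT; apply/andP; split; apply/eqP => eb1.
  by have := hdB _ Bb0; rewrite hd0 -eb1 hb1 ltnn.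
have := shB _ Bc0; rewrite -sh0 -eb1 sb1 leq_add2l.
by rewrite -hb1 eb1 hd0 ltnn.
Qed.

Section ToComplex.
Variables (B : {set I}) (D : I -> I -> S).
Hypothesis resD : based_resolution B D.

Definition level p : {set I} := [set b in B | hd b == p].

Definition graded_complex : free_complex K n := @FreeComplex K n
  (fun p => #|level p|) (fun p i => sh (enum_val i))
  (fun p => \matrix_(i, j) D (enum_val i) (enum_val j))
  (\col_i e (enum_val i)).

Definition spread p (v : 'rV[S]_#|level p|) (b : I) : S :=
  \sum_(i < #|level p|) v 0 i *+ (enum_val i == b).

Definition gather p (w : I -> S) : 'rV[S]_#|level p| := \row_i w (enum_val i).

Lemma levelP p b : (b \in level p) = (b \in B) && (hd b == p).
Proof. by rewrite inE. Qed.

Lemma spread_in p (v : 'rV_#|level p|) i : spread v (enum_val i) = v 0 i.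
Proof.
rewrite /spread (bigD1 i) //= eqxx mulr1n big1 ?addr0 // => j ji.
by rewrite (inj_eq enum_val_inj) (negPf ji).
Qed.

Lemma spread_out p (v : 'rV_#|level p|) b : b \notin level p -> spread v b = 0.
Proof.
move=> hb; rewrite /spread big1 // => i _.
by case: eqP => // eb; rewrite -eb enum_valP in hb.
Qed.

Lemma gather_spread p (v : 'rV_#|level p|) : gather p (spread v) = v.
Proof. by apply/rowP => i; rewrite mxE spread_in. Qed.

Lemma spread_gather p w b : b \in level p -> spread (gather p w) b = w b.
Proof. by move=> hb; rewrite -(enum_rankK_in hb hb) spread_in mxE. Qed.

Lemma gather_bd_on p w :
  gather p (bd_on B D w) = gather p.+1 w *m diff graded_complex p.
Proof.
apply/rowP => j; rewrite !mxE /=.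
under [RHS]eq_bigr do rewrite !mxE.
rewrite -(big_enum_val (fun b => w b * D b (enum_val j))) /=.
have := enum_valP j; rewrite levelP => /andP[Bj /eqP hj].
rewrite /bd_on (big_setID (level p.+1)) /= [X in _ + X]big1 ?addr0.
  by apply: eq_bigl => b; rewrite !inE; case: (b \in B).
move=> b; rewrite !inE => /andP[+ Bb]; rewrite Bb /= => hb.
have [->|/(based_hd resD Bb Bj) hbj] := eqVneq (D b (enum_val j)) 0.
  by rewrite mulr0.
by rewrite hbj hj eqxx in hb.
Qed.

Lemma gather_aug_on w : (gather 0 w *m aug graded_complex) 0 0 = aug_on B w.
Proof.
rewrite !mxE /=; under eq_bigr do rewrite !mxE.
rewrite -(big_enum_val (fun b => w b * e b)) /=.
rewrite /aug_on [RHS](big_setID (level 0)) /= [X in _ = _ + X]big1 ?addr0.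
  by apply: eq_bigl => b; rewrite !inE; case: (b \in B).
move=> b; rewrite !inE => /andP[+ Bb]; rewrite Bb /= => hb.
have [->|/(based_aug_hd resD Bb) hb0] := eqVneq (e b) 0; first by rewrite mulr0.
by rewrite hb0 eqxx in hb.
Qed.

Lemma bd_on_spread p (v : 'rV_#|level p.+1|) c : c \in B -> c \notin level p ->
  bd_on B D (spread v) c = 0.
Proof.
move=> Bc hc; rewrite /bd_on big1 // => b Bb.
have [->|/(based_hd resD Bb Bc) hbc] := eqVneq (D b c) 0; first by rewrite mulr0.
rewrite spread_out ?mul0r // levelP Bb hbc eqSS.
by move: hc; rewrite levelP Bc.
Qed.

Lemma bd_on_spread0 (v : 'rV_#|level 0|) c : c \in B -> bd_on B D (spread v) c = 0.
Proof.
move=> Bc; rewrite /bd_on big1 // => b Bb.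
have [->|/(based_hd resD Bb Bc) hbc] := eqVneq (D b c) 0; first by rewrite mulr0.
by rewrite spread_out ?mul0r // levelP Bb hbc.
Qed.

Lemma aug_on_spread p (v : 'rV_#|level p.+1|) : aug_on B (spread v) = 0.
Proof.
rewrite /aug_on big1 // => b Bb.
have [->|/(based_aug_hd resD Bb) hb0] := eqVneq (e b) 0; first by rewrite mulr0.
by rewrite spread_out ?mul0r // levelP Bb hb0.
Qed.

Lemma graded_complex_resolution :
  {in B &, forall b c, (D b c)@_0%MM = 0} ->
  minimal_graded_free_resolution J graded_complex.
Proof.
have inB p (i : 'I_#|level p|) : enum_val i \in B.
  by have := enum_valP i; rewrite levelP => /andP[].
move=> minD; split.
- by move=> p i j m; rewrite /= mxE; apply: (based_sh resD).
- by move=> i m; rewrite /= mxE; apply: (based_aug_sh resD).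
- move=> f; have [v Jv] := based_onto resD f.
  by exists (gather 0 v); rewrite gather_aug_on.
- move=> v; split=> [Jv | [w ->]]; last first.
    by rewrite -[w]gather_spread -gather_bd_on gather_aug_on; apply: (based_aug_complex resD).
  rewrite -[v]gather_spread gather_aug_on in Jv.
  have [w vw] := based_exact resD (@bd_on_spread0 v) Jv.
  exists (gather 1 w); rewrite -gather_bd_on -[LHS]gather_spread.
  by apply/rowP => i; rewrite !mxE vw.
- move=> p v; split=> [v0 | [w ->]]; last first.
    rewrite -[w]gather_spread -!gather_bd_on; apply/rowP => i.
    by rewrite !mxE (based_complex resD).
  have v0' : {in B, forall c, bd_on B D (spread v) c = 0}.
    move=> c Bc; have [hc|hc] := boolP (c \in level p); last exact: bd_on_spread.
    rewrite -[LHS](spread_gather _ hc) gather_bd_on gather_spread v0.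
    by rewrite /spread big1 // => i _; rewrite mxE mul0rn.
  have Jv : J (aug_on B (spread v)).
    rewrite aug_on_spread -[X in J X](subrr (aug_on B (bd_on B D (fun=> 0)))).
    by apply: J_sub; apply: (based_aug_complex resD).
  have [w vw] := based_exact resD v0' Jv.
  exists (gather p.+2 w); rewrite -gather_bd_on -[LHS]gather_spread.
  by apply/rowP => i; rewrite !mxE vw.
- by move=> p i j; rewrite /= mxE; apply: minD.
Qed.

End ToComplex.

Lemma regularity_of_based_resolution (l r : nat) B D :
  based_resolution B D ->
  {in B, forall b, hd b <= l}%N -> {in B, forall b, sh b <= r + hd b}%N ->
  (exists2 b, b \in B & hd b = l /\ sh b = r + l)%N ->
  quotient_regularity J r.
Proof.
move=> resD hdB shB top.
have [B' [D' [resD' minD' shB' [b Bb [hb sb]]]]] := minimal_based_resolution resD hdB shB top.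
exists (graded_complex B' D'); first exact: graded_complex_resolution.
split=> [p i|] /=.
  have := enum_valP i; rewrite levelP => /andP[Bi /eqP hi].
  by rewrite -{2}hi shB'.
have bl : b \in level B' l by rewrite levelP Bb hb eqxx.
by exists l, (enum_rank_in bl b); rewrite enum_rankK_in.
Qed.

End BasedResolution.

Section ChangeOfIdeal.
Variables (K : fieldType) (n : nat) (J J' : {mpoly K[n]} -> Prop).

Lemma eq_quotient_regularity r : (forall f, J f <-> J' f) ->
  quotient_regularity J r -> quotient_regularity J' r.
Proof.
move=> JJ' [F [d1 d2 onto ex0 ex1 minF] reg]; exists F => //; split=> //.
  by move=> f; have [v /JJ' Jv] := onto f; exists v.
by move=> v; rewrite -ex0 JJ'.
Qed.

End ChangeOfIdeal.

(** * The Koszul complex and its contracting homotopy *)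

Section Coefficients.
Variables (K : fieldType) (n : nat).
Local Notation S := {mpoly K[n]}.
Implicit Types (p : S) (m a b : 'X_{1..n}) (i j : 'I_n) (T : {set 'I_n}).

Lemma mnm_subK a b : (b <= a)%MM -> (a - b + b = a)%MM.
Proof.
by move/mnm_lepP => le; apply/mnmP => i; rewrite mnmDE mnmBE subnK.
Qed.

Lemma mnm_addK a b : (a + b - b = a)%MM.
Proof. by apply/mnmP => i; rewrite mnmBE mnmDE addnK. Qed.

Lemma mnm1_le i m : (U_(i) <= m)%MM = (0 < m i)%N.
Proof.
apply/mnm_lepP/idP => [/(_ i)|mi j]; first by rewrite mnm1E eqxx.
by rewrite mnm1E; case: eqP => // <-.
Qed.

Lemma mcoeff_sum_monomials (E : 'X_{1..n} -> K) k m :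
  (\sum_(m' : 'X_{1..n < k}) E m' *: 'X_[m'])@_m = if (mdeg m < k)%N then E m else 0.
Proof.
case: ltnP => [/mcoeff_mpoly //|km].
rewrite raddf_sum big1 //= => m' _; rewrite mcoeffZ mcoeffX.
case: eqP => [e|_]; last by rewrite mulr0.
by have := bmdeg m'; rewrite e ltnNge km.
Qed.

Lemma mcoeff_mulX a p m :
  ('X_[a] * p)@_m = if (a <= m)%MM then p@_(m - a) else 0.
Proof.
rewrite mulrC; case: ifP => [am|/negP am].
  by rewrite -{1}(mnm_subK am) addmC mcoeffMX.
apply/eqP; rewrite mcoeff_eq0 (perm_mem (msuppMX _ _)); apply/mapP => -[m' _ e].
by apply: am; rewrite e lem_addr.
Qed.

Lemma mcoeff_mulXU i p m :
  ('X_i * p)@_m = if (0 < m i)%N then p@_(m - U_(i)) else 0.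
Proof. by rewrite mcoeff_mulX mnm1_le. Qed.

End Coefficients.

Section Koszul.
Variables (K : fieldType) (n : nat).
Local Notation S := {mpoly K[n]}.
Implicit Types (p : S) (m a b : 'X_{1..n}) (i j : 'I_n) (T : {set 'I_n}).

(** The sign with which [e_T] occurs in the contraction of [e_(i |: T)] by [i]. *)
Definition ksign i T : K := (-1) ^+ #|[set j in T | (j < i)%N]|.

Lemma ksign_add i j T : j \notin T ->
  ksign i (j |: T) = if (j < i)%N then - ksign i T else ksign i T.
Proof.
move=> jT; rewrite /ksign.
have -> : [set j0 in j |: T | (j0 < i)%N] =
    if (j < i)%N then j |: [set j0 in T | (j0 < i)%N] else [set j0 in T | (j0 < i)%N].
  apply/setP => h; case: ifP => ji; rewrite !inE; case: eqP => [->|] //=.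
  by rewrite ji (negPf jT).
case: ifP => // _; rewrite cardsU1 !inE (negPf jT) /=.
by rewrite exprS mulN1r.
Qed.

(** The operator [x_i - y_i] on families of polynomials indexed by exponents:
    [f a] is the coefficient of [y^a], so [y_i] shifts the family. *)
Definition x_sub_y i (f : 'X_{1..n} -> S) a : S :=
  'X_i * f a - (if (0 < a i)%N then f (a - U_(i))%MM else 0).

Definition koszul_bd (z : {set 'I_n} -> 'X_{1..n} -> S) T a : S :=
  \sum_(i | i \notin T) ksign i T *: x_sub_y i (z (i |: T)) a.

Lemma x_sub_yC i j f a : x_sub_y i (x_sub_y j f) a = x_sub_y j (x_sub_y i f) a.
Proof.
have [->//|ij] := eqVneq i j.
rewrite /x_sub_y !mnmBE !mnm1E [j == i]eq_sym (negPf ij) !subn0.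
have -> : (a - U_(j) - U_(i) = a - U_(i) - U_(j))%MM.
  by apply/mnmP => h; rewrite !mnmBE subnAC.
by case: ifP => _; case: ifP => _; ring.
Qed.

Lemma x_sub_y_sum i (P : pred 'I_n) (c : 'I_n -> K) (g : 'I_n -> 'X_{1..n} -> S) a :
  x_sub_y i (fun b => \sum_(j | P j) c j *: g j b) a = \sum_(j | P j) c j *: x_sub_y i (g j) a.
Proof.
rewrite /x_sub_y mulr_sumr; under [RHS]eq_bigr do rewrite scalerBr.
rewrite sumrB; congr (_ - _); first by apply: eq_bigr => j _; rewrite scalerAr.
by case: ifP => // _; rewrite big1 // => j _; rewrite scaler0.
Qed.

(** Pairs are matched with their transposes, so no division by 2 is needed. *)
Lemma sum_antisym (V : zmodType) (P : pred 'I_n) (F : 'I_n -> 'I_n -> V) :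
  (forall i j, P i -> P j -> (i < j)%N -> F i j = - F j i) ->
  \sum_(i | P i) \sum_(j | P j && (j != i)) F i j = 0.
Proof.
move=> anti.
rewrite (eq_bigr (fun i => \sum_(j | P j && (i < j)%N) F i j +
    \sum_(j | P j && (j < i)%N) F i j)); last first.
  move=> i Pi; rewrite (bigID (fun j : 'I_n => (i < j)%N)) /=.
  congr (_ + _); apply: eq_bigl => j; rewrite -andbA; congr (_ && _);
  by rewrite -val_eqE /= neq_ltn; case: ltngtP.
rewrite big_split /= [X in _ + X](exchange_big_dep P) //=; last by move=> i j _ /andP[].
rewrite -big_split big1 //= => i Pi.
rewrite [X in _ + X](eq_bigl (fun j => P j && (i < j)%N)); last first.
  by move=> j; rewrite Pi.
rewrite -big_split big1 //= => j /andP[Pj ij].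
by rewrite anti // addNr.
Qed.

Lemma koszul_bd_bd z T a : koszul_bd (koszul_bd z) T a = 0.
Proof.
pose F i j := (ksign i T * ksign j (i |: T)) *: x_sub_y i (x_sub_y j (z (j |: (i |: T)))) a.
rewrite -[RHS](@sum_antisym S (fun i => i \notin T) F).
  rewrite {1}/koszul_bd; apply: eq_bigr => i iT.
  rewrite x_sub_y_sum scaler_sumr; apply: eq_big => [j|j _].
    by rewrite in_setU1 negb_or andbC.
  by rewrite scalerA.
move=> i j iT jT ij; rewrite /F x_sub_yC setUCA -scaleNr; congr (_ *: _).
rewrite !ksign_add // ij ltnNge (ltnW ij) /= mulrN; congr (- _).
exact: mulrC.
Qed.

Definition low i T m := [forall j : 'I_n, (j < i)%N ==> (j \notin T) && (m j == 0%N)].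

(** [first i T m] says that [i] is the smallest index that occurs in the set [T]
    or in the monomial [m].  The basis element [x^m e_T] of the Koszul complex
    on the [x_i] determines this index, and the differential keeps the union
    of the two supports, hence the index. *)
Definition first i T m := low i T m && ((i \in T) || (0 < m i)%N).

(** Division by the i-th variable of the terms to which the homotopy applies.
    The test on [m] is made after the division, which changes the exponent at
    [i] only. *)
Definition divlow i T p : S :=
  \sum_(m : 'X_{1..n < msize p}) (if low i T m then p@_(m + U_(i)) else 0) *: 'X_[m].

Lemma mcoeff_divlow i T p m :
  (divlow i T p)@_m = if low i T m then p@_(m + U_(i)) else 0.
Proof.
rewrite /divlow (mcoeff_sum_monomials (fun m => if low i T m then p@_(m + U_(i)) else 0)).
case: ltnP => // pm; case: ifP => // _; apply/esym/eqP; rewrite mcoeff_eq0.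
by apply: msize_mdeg_ge; rewrite mdegD (leq_trans pm) ?leq_addr.
Qed.

(** The differential of the Koszul complex on the [x_i] alone. *)
Definition x_bd (Z : {set 'I_n} -> S) T : S :=
  \sum_(i | i \notin T) ksign i T *: ('X_i * Z (i |: T)).

(** The homotopy moves the first index [i] from the monomial into the set: it
    sends [x^m e_T] to [x^(m - U_(i)) e_(i |: T)] if [i \notin T] and to 0
    otherwise.  It is written out by the target set, and no sign occurs because
    [i] precedes every element of [T]. *)
Definition x_htpy (Z : {set 'I_n} -> S) T : S :=
  \sum_(i | i \in T) divlow i T (Z (T :\ i)).

Lemma firstP i j T m : first i T m -> (j < i)%N -> (j \notin T) /\ m j = 0%N.
Proof.
by case/andP=> /forallP/(_ j)/implyP h _ /h /andP[-> /eqP].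
Qed.

Lemma first_in i T m : first i T m -> i \notin T -> (0 < m i)%N.
Proof. by case/andP=> _ /orP[->|]. Qed.

Lemma first_intro i T m : (forall j : 'I_n, (j < i)%N -> (j \notin T) /\ m j = 0%N) ->
  (i \in T) || (0 < m i)%N -> first i T m.
Proof.
move=> h hi; rewrite /first hi andbT; apply/forallP => j; apply/implyP => /h[-> ->].
by [].
Qed.

Lemma first_uniq i j T m : first i T m -> first j T m -> i = j.
Proof.
move=> fi fj; apply/val_inj; case: (ltngtP i j) => // lt.
  have [iT mi] := firstP fj lt; have := first_in fi iT; by rewrite mi.
have [jT mj] := firstP fi lt; have := first_in fj jT; by rewrite mj.
Qed.

Lemma first_exists T m : (T != set0) || (m != 0%MM) -> exists i, first i T m.
Proof.
move=> h; have [i0 hi0] : exists i, (i \in T) || (0 < m i)%N.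
  case/orP: h => [/set0Pn[i iT]|]; first by exists i; rewrite iT.
  rewrite -mdeg_eq0 mdegE sum_nat_eq0 negb_forall => /existsP[i] /=.
  by rewrite -lt0n => hi; exists i; rewrite hi orbT.
case: (@arg_minnP _ i0 (fun i => (i \in T) || (0 < m i)%N) (@nat_of_ord n) hi0) => i hi min; exists i.
apply: first_intro => // j ji.
have : ~~ ((j \in T) || (0 < m j)%N) by apply: contraTN ji => /min; rewrite -leqNgt.
by rewrite negb_or -eqn0Ngt => /andP[jT /eqP].
Qed.

Lemma mcoeff_x_htpy Z T m i0 : first i0 T m ->
  (x_htpy Z T)@_m = if i0 \in T then (Z (T :\ i0))@_(m + U_(i0)) else 0.
Proof.
move=> f0; rewrite raddf_sum /=.
have ne0 i : i \in T -> i != i0 -> (divlow i T (Z (T :\ i)))@_m = 0.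
  move=> iT ii0; rewrite mcoeff_divlow; case: ifP => // li.
  by case/eqP: ii0; apply: first_uniq f0; rewrite /first li iT.
case: ifP => i0T; last by rewrite big1 // => i iT; apply: ne0 => //; apply: contraFneq i0T => <-.
rewrite (bigD1 i0) //= big1 ?addr0; last by move=> i /andP[]; apply: ne0.
by rewrite mcoeff_divlow; case/andP: f0 => ->.
Qed.

Lemma mcoeff_x_bd Z T m :
  (x_bd Z T)@_m = \sum_(i | (i \notin T) && (0 < m i)%N) ksign i T * (Z (i |: T))@_(m - U_(i)).
Proof.
rewrite raddf_sum /= big_mkcondr /=; apply: eq_bigr => i _.
by rewrite mcoeffZ mcoeff_mulXU; case: ifP; rewrite ?mulr0.
Qed.

Lemma ksign_first i T m : first i T m -> ksign i (T :\ i) = 1.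
Proof.
move=> fi; rewrite /ksign; set A := [set _ in _ | _].
suff -> : A = set0 by rewrite cards0.
apply/setP => j; rewrite !inE; case: (ltnP j i) => [ji|]; last by rewrite andbF.
by have [/negPf-> _] := firstP fi ji; rewrite andbF.
Qed.

Lemma first_add i i0 T m : first i0 T m -> i \notin T -> (0 < m i)%N ->
  first i0 (i |: T) (m - U_(i)).
Proof.
move=> f0 iT mi; apply: first_intro => [j /(firstP f0)[jT mj]|].
  split; last by rewrite mnmBE mj.
  by rewrite in_setU1 negb_or jT andbT; apply: contraTneq mi => <-; rewrite mj.
rewrite in_setU1; have [//|ii0] := eqVneq i0 i.
rewrite mnmBE mnm1E eq_sym (negPf ii0) subn0.
by case/andP: f0.
Qed.

(** If the first index [i0] is in [T], it contributes the right-hand side to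
    [x_htpy (x_bd Z)], and the other terms cancel in pairs, since [i0] precedes
    the other index and its removal changes the sign.  If [i0] is not in [T],
    only the [i0]-term of [x_bd (x_htpy Z)] is nonzero.  The coefficient at
    [T = set0], [m = 0] is excluded: it is the homology. *)
Lemma koszul_homotopy Z T m : (T != set0) || (m != 0%MM) ->
  (x_bd (x_htpy Z) T)@_m + (x_htpy (x_bd Z) T)@_m = (Z T)@_m.
Proof.
case/first_exists => i0 f0; rewrite (mcoeff_x_htpy _ f0) !mcoeff_x_bd.
have htpyE i : (i \notin T) && (0 < m i)%N -> (x_htpy Z (i |: T))@_(m - U_(i)) =
   if i0 \in i |: T then (Z ((i |: T) :\ i0))@_(m - U_(i) + U_(i0)) else 0.
  by case/andP=> iT mi; apply: mcoeff_x_htpy; apply: first_add.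
under eq_bigr => i hi do rewrite htpyE //.
case: ifP => i0T; last first.
  rewrite addr0 (bigD1 i0) /=; last by rewrite i0T (first_in f0) // i0T.
  rewrite setU11 setU1K ?i0T // mnm_subK ?mnm1_le ?(first_in f0) ?i0T //.
  rewrite big1 ?addr0; last first.
    by move=> i /andP[_ ii0]; rewrite in_setU1 eq_sym (negPf ii0) i0T mulr0.
  have -> : ksign i0 T = ksign i0 (T :\ i0).
    by congr ksign; apply/setP => j; rewrite !inE; case: eqP => // ->; rewrite i0T.
  by rewrite (ksign_first f0) mul1r.
rewrite [X in _ + X](bigD1 i0) /=; last first.
  by rewrite !inE eqxx mnmDE mnm1E eqxx addn1.
rewrite (ksign_first f0) mul1r setD1K // mnm_addK addrCA -[RHS]addr0; congr (_ + _).
rewrite [X in _ + X](eq_bigl (fun i => (i \notin T) && (0 < m i)%N)); last first.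
  move=> i; rewrite !inE mnmDE mnm1E; have [->|ii0] := eqVneq i i0.
    by rewrite i0T /= andbF.
  by rewrite /= addn0 andbT.
rewrite -big_split /= big1 // => i /andP[iT mi].
have ii0 : i != i0 by apply: contraNneq iT => ->.
rewrite in_setU1 i0T orbT.
have -> : (i |: T) :\ i0 = i |: T :\ i0.
  by apply/setP => j; rewrite !inE; case: eqP => [->|]; rewrite //= eq_sym (negPf ii0).
have -> : (m - U_(i) + U_(i0) = m + U_(i0) - U_(i))%MM.
  by rewrite addmC addmBA ?mnm1_le // addmC.
rewrite -{1}(setD1K i0T) ksign_add ?setD11 //.
have -> : (i0 < i)%N.
  rewrite ltn_neqAle eq_sym ii0 leqNgt; apply/negP => /(firstP f0)[_ mi0].
  by rewrite mi0 in mi.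
by rewrite mulNr addNr.
Qed.

End Koszul.

(** * Regularity of Artinian monomial quotients *)

Section StandardKoszul.
Variables (K : fieldType) (n r : nat) (std : pred 'X_{1..n}).
Hypothesis std_down : forall a b, (a <= b)%MM -> std b -> std a.
Hypothesis std_deg : forall a, std a -> (mdeg a <= r)%N.
Local Notation S := {mpoly K[n]}.
Local Notation bmon := 'X_{1..n < r.+1}.
Implicit Types (p f : S) (m : 'X_{1..n}) (i j : 'I_n) (T : {set 'I_n}).
Implicit Types (z w : {set 'I_n} -> 'X_{1..n} -> S).

(** The monomial ideal whose standard monomials are those that satisfy [std]. *)
Definition off_std f : Prop := forall m, std m -> f@_m = 0.

Lemma off_std_sub f p : off_std f -> off_std p -> off_std (f - p).
Proof. by move=> of_ op m sm; rewrite mcoeffB of_ ?op ?subr0. Qed.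

Lemma off_std_mul f p : off_std p -> off_std (f * p).
Proof.
move=> op m sm; rewrite mcoeffMr big1 // => -[a b] /= /eqP e.
by rewrite op ?mulr0 //; apply: std_down sm; rewrite [X in (_ <= X)%MM]e lem_addr.
Qed.

Lemma off_std_sum (A : Type) (s : seq A) (P : pred A) (F : A -> S) :
  (forall x, P x -> off_std (F x)) -> off_std (\sum_(x <- s | P x) F x).
Proof. by move=> oF m sm; rewrite raddf_sum big1 //= => x /oF ->. Qed.

Lemma off_stdX a : ~~ std a -> off_std ('X_[a]).
Proof. by move=> na m sm; rewrite mcoeffX; case: eqP => // e; rewrite e sm in na. Qed.

Lemma std_pred i a : std a -> std (a - U_(i))%MM.
Proof. by apply: std_down; apply: lem_subr. Qed.

Lemma eq_koszul_bd z w T a : (forall T b, std b -> z T b = w T b) -> std a ->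
  koszul_bd z T a = koszul_bd w T a.
Proof.
move=> zw sa; apply: eq_bigr => i _.
by rewrite /x_sub_y !zw //; apply: std_pred.
Qed.

Lemma koszul_bdB z w T a : koszul_bd (fun T a => z T a - w T a) T a = koszul_bd z T a - koszul_bd w T a.
Proof.
rewrite /koszul_bd -sumrB; apply: eq_bigr => i _; rewrite -scalerBr; congr (_ *: _).
by rewrite /x_sub_y; case: ifP => _; ring.
Qed.

Lemma koszul_bdD z w T a : koszul_bd (fun T a => z T a + w T a) T a = koszul_bd z T a + koszul_bd w T a.
Proof.
rewrite /koszul_bd -big_split /=; apply: eq_bigr => i _; rewrite -scalerDr; congr (_ *: _).
by rewrite /x_sub_y; case: ifP => _; ring.
Qed.

Lemma x_htpy0 (Z : {set 'I_n} -> S) T : (forall T, Z T = 0) -> x_htpy Z T = 0.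
Proof.
move=> Z0; apply/mpolyP => m; rewrite raddf_sum big1 ?mcoeff0 //= => i _.
by rewrite mcoeff_divlow Z0 !mcoeff0 if_same.
Qed.

(** In the lowest degree of [a] that occurs, [x_i - y_i] acts as [x_i]. *)
Lemma koszul_bd_lowest z T a : std a ->
  (forall T b, std b -> (mdeg b < mdeg a)%N -> z T b = 0) ->
  koszul_bd z T a = x_bd (z^~ a) T.
Proof.
move=> sa z0; apply: eq_bigr => i _; rewrite /x_sub_y; case: ifP => ai; rewrite ?subr0 //.
suff lt : (mdeg (a - U_(i))%MM < mdeg a)%N.
  by rewrite [z _ (a - _)%MM]z0 ?subr0 ?std_pred.
have := congr1 (@mdeg n) (mnm_subK (a := a) (b := U_(i)%MM) _).
by rewrite mnm1_le ai mdegD mdeg1 addn1 => /(_ isT) <-.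
Qed.

(** The augmentation [S (x) A -> S/J], lifted to [S]: it sends [y^a] to [x^a]. *)
Definition koszul_aug z : S := \sum_(a : bmon | std a) z set0 a * 'X_[a].

Lemma bmon_pred_subproof (a : bmon) i : (mdeg (a - U_(i))%MM < r.+1)%N.
Proof. exact: leq_ltn_trans (mdegB _ _) (bmdeg a). Qed.

Definition bmon_pred (a : bmon) i : bmon := BMultinom (bmon_pred_subproof a i).

Lemma sum_std_shift i (F : 'X_{1..n} -> S) :
  \sum_(a : bmon | std a && (0 < a i)%N) F a =
  \sum_(a : bmon | std (a + U_(i))%MM) F (a + U_(i))%MM.
Proof.
pose h (a : bmon) : bmon := insubd (BMultinom (bm0_proof n r)) (a + U_(i))%MM.
have hE (a : bmon) : std (a + U_(i))%MM -> h a = (a + U_(i))%MM :> 'X_{1..n}.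
  by move=> sa; rewrite /h val_insubd ltnS std_deg.
rewrite (reindex_onto h (bmon_pred^~ i)) /=; last first.
  move=> a /andP[sa ai]; apply/val_inj.
  have e : (bmon_pred a i + U_(i) = a)%MM by rewrite /= mnm_subK ?mnm1_le.
  by rewrite [LHS]hE e.
rewrite [RHS](eq_bigl (fun a => [&& std (h a), (0 < h a i)%N & bmon_pred (h a) i == a])); last first.
  move=> a; apply/idP/and3P => [sa|[sh hi /eqP e]].
    rewrite hE // mnmDE mnm1E eqxx addn1; split=> //.
    by rewrite -val_eqE /= hE // mnm_addK.
  by rewrite -e /= mnm_subK ?mnm1_le.
apply: eq_big => [a|a /andP[/andP[sh hi] /eqP e]]; first by rewrite andbA.
by congr F; rewrite -[in RHS]e /= mnm_subK ?mnm1_le.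
Qed.

(** The images of [x_i y^a] and of [y_i y^a] agree when [y_i y^a] is standard, and
    otherwise [y_i y^a = 0] in [A] while [x_i x^a] lies in the ideal. *)
Lemma koszul_aug_bd w : off_std (koszul_aug (koszul_bd w)).
Proof.
rewrite /koszul_aug /koszul_bd; under eq_bigr do rewrite mulr_suml.
rewrite exchange_big /=; apply: off_std_sum => i _.
under eq_bigr do rewrite -scalerAl.
rewrite -scaler_sumr -mul_mpolyC; apply: off_std_mul.
set f := w _; rewrite /x_sub_y.
under eq_bigr do rewrite mulrBl.
rewrite sumrB.
rewrite [X in _ - X](eq_bigr (fun a : bmon => if (0 < a i)%N then f (a - U_(i))%MM * 'X_[a] else 0)); last first.
  by move=> a _; case: ifP; rewrite ?mul0r.
rewrite -big_mkcondr /= (sum_std_shift i (fun a => f (a - U_(i))%MM * 'X_[a])).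
rewrite (bigID (fun a : bmon => std (a + U_(i))%MM)) /=.
rewrite [X in X + _ - _](eq_big (fun a : bmon => std (a + U_(i))%MM)
  (fun a : bmon => f (a + U_(i) - U_(i))%MM * 'X_[a + U_(i)])).
- rewrite addrAC subrr add0r; apply: off_std_sum => a /andP[_ na].
  by rewrite mulrAC mulrC -mpolyXD addmC; apply: off_std_mul; apply: off_stdX.
- by move=> a; apply: andb_idl; apply: std_down; apply: lem_addr.
by move=> a _; rewrite mnm_addK mpolyXD; ring.
Qed.

(** A term [x^m y^b] with [m + b = a] and [b <> a] has [b] of smaller degree. *)
Lemma mcoeff_koszul_aug_lowest z a : std a ->
  (forall b, std b -> (mdeg b < mdeg a)%N -> z set0 b = 0) ->
  (koszul_aug z)@_a = (z set0 a)@_0%MM.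
Proof.
move=> sa z0; have ar : (mdeg a < r.+1)%N by rewrite ltnS std_deg.
rewrite /koszul_aug (bigD1 (BMultinom ar)) //= mcoeffD.
have XE p : (p * 'X_[a])@_a = p@_0%MM by rewrite -{1}(addm0 a) mcoeffMX.
rewrite [X in X + _]XE raddf_sum big1 ?addr0 //= => b /andP[sb ba].
rewrite mulrC mcoeff_mulX; case: ifP => // le; rewrite z0 ?mcoeff0 //.
rewrite -[X in (_ < mdeg X)%N](mnm_subK le) mdegD -[X in (X < _)%N]add0n ltn_add2r lt0n mdeg_eq0.
apply: contra ba => /eqP e; rewrite -val_eqE /= -(mnm_subK le) e.
by rewrite add0m.
Qed.

(** The difference [y] between [z] and a boundary is made to vanish for [a] of
    degree [< q], for growing [q].  In degree [q] it is then a cycle of the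
    Koszul complex on the [x_i], so subtracting the boundary of its homotopy
    image leaves only constants in [T = set0], and these are the coefficients
    of standard monomials in the augmentation, hence zero. *)
Lemma koszul_bd_exact z : (forall T a, std a -> koszul_bd z T a = 0) -> off_std (koszul_aug z) ->
  exists w, forall T a, std a -> z T a = koszul_bd w T a.
Proof.
move=> zcyc zoff.
suff /(_ r.+1)[w hw] : forall q, exists w, forall T a, std a -> (mdeg a < q)%N ->
    z T a = koszul_bd w T a.
  by exists w => T a sa; apply: hw => //; rewrite ltnS std_deg.
elim=> [|q [w IH]]; first by exists z.
pose y T a := z T a - koszul_bd w T a; pose w1 T a := x_htpy (y^~ a) T.
have ylow T a : std a -> (mdeg a < q)%N -> y T a = 0.
  by move=> sa aq; rewrite /y IH ?subrr.
have w1low T a : std a -> (mdeg a < q)%N -> w1 T a = 0.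
  by move=> sa aq; apply: x_htpy0 => T'; apply: ylow.
pose y' T a := y T a - koszul_bd w1 T a.
have y'low T a : std a -> (mdeg a < q)%N -> y' T a = 0.
  move=> sa aq; rewrite /y' ylow // sub0r koszul_bd_lowest //; last first.
    by move=> T' b sb ba; apply: w1low => //; apply: ltn_trans aq.
  by rewrite /x_bd big1 ?oppr0 // => i _; rewrite w1low ?mulr0 ?scaler0.
exists (fun T a => w T a + w1 T a) => T a sa; rewrite ltnS leq_eqVlt => /predU1P[aq|aq]; last first.
  apply/eqP; rewrite koszul_bdD -subr_eq0 opprD addrA; apply/eqP; exact: y'low.
apply/eqP; rewrite koszul_bdD -subr_eq0 opprD addrA; apply/eqP.
rewrite -/(y T a) -/(y' T a); apply/mpolyP => m; rewrite mcoeff0.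
have ycyc T' : x_bd (y^~ a) T' = 0.
  rewrite -koszul_bd_lowest //; last by move=> T2 b sb; rewrite aq; apply: ylow.
  by rewrite koszul_bdB koszul_bd_bd zcyc // subr0.
have [h|] := boolP ((T != set0) || (m != 0%MM)).
  rewrite /y' koszul_bd_lowest //; last by move=> T2 b sb; rewrite aq; apply: w1low.
  rewrite mcoeffB -(koszul_homotopy (y^~ a) h) (x_htpy0 _ ycyc) mcoeff0 addr0.
  by rewrite subrr.
rewrite negb_or !negbK => /andP[/eqP-> /eqP->].
rewrite -mcoeff_koszul_aug_lowest //; last by move=> b sb; rewrite aq; apply: y'low.
have -> : koszul_aug y' = koszul_aug z - koszul_aug (koszul_bd w) - koszul_aug (koszul_bd w1).
  by rewrite /koszul_aug -!sumrB; apply: eq_bigr => b _; rewrite /y' /y !mulrBl.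
by rewrite !mcoeffB zoff // !koszul_aug_bd // !subr0.
Qed.

Local Notation kindex := ({set 'I_n} * bmon)%type.

Definition koszul_basis : {set kindex} := [set b : kindex | std b.2].

Definition koszul_diff (b c : kindex) : S :=
  \sum_(i | i \notin c.1) ksign K i c.1 *:
    ('X_i *+ (b == (i |: c.1, c.2)) -
     ((0 < c.2 i)%N && (b == (i |: c.1, bmon_pred c.2 i)))%:R).

Definition koszul_eps (b : kindex) : S := if b.1 == set0 then 'X_[b.2] else 0.

Definition koszul_hd (b : kindex) : nat := #|b.1|.

Definition koszul_sh (b : kindex) : nat := #|b.1| + mdeg b.2.

(** Vectors on the finite basis are regarded as families indexed by all
    exponents.  The value 0 at exponents of degree above [r] is arbitrary:
    these are not standard, and the coefficient of a standard [y^a] in a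
    boundary involves standard exponents only. *)
Definition chain (v : kindex -> S) T a : S :=
  if insub a is Some a' then v (T, a') else 0.

Lemma chainE v (b : kindex) : chain v b.1 b.2 = v b.
Proof. by rewrite /chain valK; case: b. Qed.

Lemma chain_of_fun z T a : std a -> chain (fun b : kindex => z b.1 b.2) T a = z T a.
Proof.
move=> sa; rewrite /chain; case: insubP => [a' _ <- //|].
by rewrite ltnS std_deg.
Qed.

Lemma chain_std v w T a : (forall b : kindex, b \in koszul_basis -> v b = w b.1 b.2) -> std a ->
  chain v T a = w T a.
Proof.
move=> vw sa; rewrite /chain; case: insubP => [a' _ ea|].
  by rewrite vw /= ?ea // inE /= ea.
by rewrite ltnS std_deg.
Qed.

Lemma sum_delta (A : finType) (P : pred A) (F : A -> S) x : P x ->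
  \sum_(b | P b) F b *+ (b == x) = F x.
Proof.
move=> Px; rewrite (bigD1 x) //= eqxx mulr1n big1 ?addr0 // => b /andP[_ /negPf->].
by [].
Qed.

Lemma bd_on_koszul v c : c \in koszul_basis ->
  bd_on koszul_basis koszul_diff v c = koszul_bd (chain v) c.1 c.2.
Proof.
rewrite inE => sc; rewrite /bd_on /koszul_diff.
under eq_bigr do rewrite mulr_sumr.
rewrite exchange_big /=; apply: eq_bigr => i _.
under eq_bigr do rewrite -scalerAr mulrBr.
rewrite -scaler_sumr sumrB; congr (_ *: (_ - _)).
  rewrite (eq_bigr (fun b => ('X_i * v b) *+ (b == (i |: c.1, c.2)))); last first.
    by move=> b _; rewrite mulrnAr mulrC.
  by rewrite sum_delta ?inE //= -(chainE v (i |: c.1, c.2)).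
case: ifP => ci; last by rewrite big1 // => b _; rewrite mulr0.
rewrite (eq_bigr (fun b => v b *+ (b == (i |: c.1, bmon_pred c.2 i)))); last first.
  by move=> b _; rewrite mulr_natr.
by rewrite sum_delta ?inE /= ?std_pred // -(chainE v (i |: c.1, bmon_pred c.2 i)).
Qed.

Lemma aug_on_koszul v : aug_on koszul_eps koszul_basis v = koszul_aug (chain v).
Proof.
rewrite /aug_on /koszul_aug.
rewrite (eq_bigr (fun b : kindex => if b.1 == set0 then chain v set0 b.2 * 'X_[b.2] else 0)); last first.
  move=> b _; rewrite /koszul_eps; case: eqP => [e|]; last by rewrite mulr0.
  by rewrite -chainE e.
rewrite -big_mkcondr /= (eq_bigl (fun b : kindex => (b.1 == set0) && std b.2)); last first.
  by move=> b; rewrite inE andbC.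
by rewrite -(pair_big (pred1 set0) (fun a : bmon => std a)
  (fun (T : {set 'I_n}) (a : bmon) => chain v set0 a * 'X_[a])) /= big_pred1_eq.
Qed.

Lemma msupp_koszul_diff b c m : m \in msupp (koszul_diff b c) ->
  #|b.1| = #|c.1|.+1 /\ (mdeg m + koszul_sh c = koszul_sh b)%N.
Proof.
move/msupp_sum_le/flattenP => [s /mapP[i]]; rewrite mem_filter => /andP[ic _] ->.
move/msuppZ_le/msuppB_le; rewrite mem_cat /koszul_sh => /orP[].
  case: eqP => [->|_]; last by rewrite mulr0n msupp0.
  rewrite mulr1n msuppX inE /= cardsU1 ic => /eqP->.
  by rewrite mdeg1 addnA.
case: andP => [[ci /eqP->]|_]; last by rewrite mulr0n msupp0.
rewrite msupp1 inE /= cardsU1 ic => /eqP->; split=> //.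
rewrite mdeg0 add0n add1n addSn -addnS; congr (_ + _)%N.
have := congr1 (@mdeg n) (mnm_subK (a := c.2) (b := U_(i)%MM) _).
by rewrite mnm1_le ci mdegD mdeg1 addn1 => /(_ isT) <-.
Qed.

(** All clauses are facts about [koszul_bd], which [bd_on_koszul] transports to
    the finite basis. *)
Lemma koszul_resolution : based_resolution off_std koszul_hd koszul_sh koszul_eps koszul_basis koszul_diff.
Proof.
have ne0 (p : S) : p != 0 -> exists m, m \in msupp p.
  by rewrite -msupp_eq0; case: (msupp p) => // m s _; exists m; rewrite inE eqxx.
split.
- by move=> b c _ _ /ne0[m] /msupp_koszul_diff[].
- by move=> b c m _ _ /msupp_koszul_diff[].
- by move=> b _; rewrite /koszul_eps /koszul_hd; case: (eqVneq b.1) => [->|_]; rewrite ?cards0 ?eqxx.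
- move=> b m _; rewrite /koszul_eps /koszul_sh; case: eqP => [->|]; rewrite ?msupp0 //.
  by rewrite msuppX inE cards0 => /eqP->.
- move=> f; exists (fun b : kindex => (f@_(b.2))%:MP) => m sm.
  rewrite aug_on_koszul mcoeffB raddf_sum /=.
  have mr : (mdeg m < r.+1)%N by rewrite ltnS std_deg.
  rewrite (bigD1 (BMultinom mr)) //= big1 ?addr0 => [|a /andP[_ am]].
    by rewrite (chain_of_fun (fun _ a => (f@_a)%:MP)) // mul_mpolyC mcoeffZ mcoeffX eqxx mulr1 subrr.
  rewrite /chain valK /= mul_mpolyC mcoeffZ mcoeffX.
  by move: am; rewrite -val_eqE /= => /negPf->; rewrite mulr0.
- move=> w c Bc; rewrite bd_on_koszul //.
  rewrite (@eq_koszul_bd _ (koszul_bd (chain w))) ?koszul_bd_bd //; last by move: Bc; rewrite inE.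
  by move=> T a; apply: chain_std => b; apply: bd_on_koszul.
- move=> w; rewrite aug_on_koszul.
  rewrite (_ : koszul_aug _ = koszul_aug (koszul_bd (chain w))); first exact: koszul_aug_bd.
  apply: eq_bigr => a sa; rewrite (chain_std (w := koszul_bd (chain w))) //.
  by move=> b; apply: bd_on_koszul.
- move=> v v0; rewrite aug_on_koszul => Jv.
  have [|w hw] := koszul_bd_exact _ Jv.
    move=> T a sa; have ar : (mdeg a < r.+1)%N by rewrite ltnS std_deg.
    by rewrite -(bd_on_koszul v (c := (T, BMultinom ar))) ?v0 ?inE.
  exists (fun b : kindex => w b.1 b.2) => b Bb; have := Bb; rewrite inE => sb.
  rewrite bd_on_koszul // -chainE hw //; apply: eq_koszul_bd => // T a sa.
  by rewrite chain_of_fun.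
Qed.

(** The last Koszul module has the basis element [e_setT (x) y^a], of internal
    degree [r + n]. *)
Theorem artinian_monomial_regularity a : std a -> mdeg a = r ->
  quotient_regularity off_std r.
Proof.
move=> sa ar; apply: (regularity_of_based_resolution _ _ koszul_resolution (l := n)).
- exact: off_std_sub.
- exact: off_std_mul.
- by move=> b _; have := max_card b.1; rewrite card_ord.
- move=> b; rewrite inE => /std_deg; rewrite /koszul_hd /koszul_sh addnC.
  by rewrite leq_add2r.
have ar1 : (mdeg a < r.+1)%N by rewrite ar.
exists (setT, BMultinom ar1); first by rewrite inE.
by rewrite /koszul_hd /koszul_sh /= cardsT card_ord ar addnC.
Qed.

End StandardKoszul.

(** * Monomials outside the ideal of bounded support *)

Section BoundedSupport.
Variables (n d k : nat).
Implicit Types (m u : 'X_{1..n}) (T : {set 'I_n}).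

Definition small_sums m : bool :=
  [forall T : {set 'I_n}, (#|T| <= k)%N ==> (\sum_(i in T) m i < d)%N].

Lemma small_sumsP m :
  reflect (forall T, #|T| <= k -> \sum_(i in T) m i < d)%N (small_sums m).
Proof.
apply: (iffP forallP) => h T; first by move/(implyP (h T)).
by apply/implyP; apply: h.
Qed.

Lemma small_sums_down a b : (a <= b)%MM -> small_sums b -> small_sums a.
Proof.
move=> /mnm_lepP ab /small_sumsP sb; apply/small_sumsP => T Tk.
by apply: leq_ltn_trans (sb T Tk); apply: leq_sum => i _; apply: ab.
Qed.

Lemma sub_mnm_deg m : (d <= mdeg m)%N -> exists2 u, (u <= m)%MM & mdeg u = d.
Proof.
move e: (mdeg m - d)%N => c; elim: c m e => [|c IH] m e dm.
  by exists m; [exact: lepm_refl | apply/eqP; rewrite eqn_leq dm -subn_eq0 e].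
have [i mi] : exists i, (0 < m i)%N.
  have : mdeg m != 0%N by lia.
  rewrite mdegE sum_nat_eq0 negb_forall => /existsP[i] /=.
  by rewrite -lt0n; exists i.
have em := mnm_subK (a := m) (b := U_(i)%MM); rewrite mnm1_le in em.
have := congr1 (@mdeg n) (em mi); rewrite mdegD mdeg1 => dm'.
have [||u um ud] := IH (m - U_(i))%MM; [lia|lia|].
by exists u => //; apply/mnm_lepP => j; apply: leq_trans (mnm_lepP um j) _; rewrite mnmBE leq_subr.
Qed.

(** A set [T] of at most [k] exponents with sum at least [d] is the same as a
    generator that divides the monomial: the support of the generator in one
    direction, a divisor of degree [d] of the part in [T] in the other. *)
Lemma bounded_support_idealE (K : fieldType) (f : {mpoly K[n]}) :
  bounded_support_ideal d k f <-> (forall m, small_sums m -> f@_m = 0).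
Proof.
split=> [[s [sG ->]] m /small_sumsP sm | fz].
  rewrite raddf_sum big_seq big1 //= => c /sG[u [du uk ->]].
  rewrite mulrC mcoeff_mulX; case: ifP => // /mnm_lepP um.
  have := sm _ uk; rewrite ltnNge -du => /negP[].
  rewrite mdegE (bigID (mem (msupport u))) /= [X in (_ + X)%N]big1 ?addn0.
    by apply: leq_sum => i _; apply: um.
  by move=> i; rewrite inE -eqn0Ngt => /eqP.
have gen m : m \in msupp f -> exists u,
    [/\ mdeg u = d, (#|msupport u| <= k)%N & (u <= m)%MM].
  rewrite mcoeff_msupp => fm.
  have : ~~ small_sums m by apply: contraNN fm => /fz ->.
  rewrite negb_forall => /existsP[T]; rewrite negb_imply -leqNgt => /andP[Tk dT].
  pose mT := [multinom (if i \in T then m i else 0)%N | i < n].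
  have [|u um ud] := @sub_mnm_deg mT.
    rewrite mdegE; apply: leq_trans dT _; rewrite big_mkcond /=.
    by apply: leq_sum => i _; rewrite mnmE.
  exists u; split=> //.
    apply: leq_trans Tk; apply/subset_leq_card/subsetP => i; rewrite inE.
    by have := mnm_lepP um i; rewrite mnmE; case: ifP => // _; case: (u i).
  apply/mnm_lepP => i; apply: leq_trans (mnm_lepP um i) _.
  by rewrite mnmE; case: ifP.
pose h m := f@_m *: 'X_[m] : {mpoly K[n]}.
suff [s sG es] : exists2 s : seq ({mpoly K[n]} * {mpoly K[n]}),
    (forall c, c \in s -> exists u, [/\ mdeg u = d, (#|msupport u| <= k)%N & c.2 = 'X_[u]])
    & \sum_(m <- msupp f) h m = \sum_(c <- s) c.1 * c.2.
  by exists s; split=> //; rewrite -es -mpolyE.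
elim: (msupp f) gen => [|m ms IH] gen; first by exists [::]; rewrite ?big_nil.
have [|s sG es] := IH; first by move=> m' hm'; apply: gen; rewrite inE hm' orbT.
have [u [ud uk um]] := gen m (mem_head _ _).
exists ((f@_m *: 'X_[m - u], 'X_[u]) :: s).
  by move=> c; rewrite inE => /predU1P[->|/sG //]; exists u.
by rewrite !big_cons es /= -scalerAl -mpolyXD mnm_subK.
Qed.

(** Let [T] be a set of [k] indices with the largest possible sum of exponents.
    Exchanging an index shows that an exponent outside [T] is at most every
    exponent in [T], hence at most [(d - 1) %/ k]. *)
Lemma small_sums_deg m : (0 < k)%N -> (k < n)%N -> small_sums m ->
  (mdeg m <= (n - k) * ((d - 1) %/ k) + (d - 1))%N.
Proof.
move=> k0 kn /small_sumsP sm.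
have [T0 T0k] : exists T0 : {set 'I_n}, #|T0| == k.
  have [T _ cT] : exists2 T : {set 'I_n}, T \subset setT & #|T| = k.
    have : (0 < #|[set B : {set 'I_n} | B \subset setT & #|B| == k]|)%N.
      by rewrite cards_draws cardsT card_ord bin_gt0 ?(ltnW kn).
    by case/card_gt0P => T; rewrite inE => /andP[sT /eqP]; exists T.
  by exists T; apply/eqP.
have [T /eqP Tk Tmax] := @arg_maxnP _ T0 (fun T : {set 'I_n} => #|T| == k)
  (fun T => \sum_(i in T) m i)%N T0k.
have Td : (\sum_(i in T) m i < d)%N by apply: sm; rewrite Tk.
have Td1 : (\sum_(i in T) m i <= d - 1)%N.
  by move: Td; generalize (\sum_(i in T) m i)%N => s; lia.
have swap i j : i \in T -> j \notin T -> (m j <= m i)%N.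
  move=> iT jT; have jTi : j \notin T :\ i by rewrite !inE (negPf jT) andbF.
  have : (\sum_(h in j |: T :\ i) m h <= \sum_(h in T) m h)%N.
    by apply: Tmax; rewrite cardsU1 jTi -Tk (cardsD1 i T) iT.
  by rewrite big_setU1 //= (big_setD1 i iT) /= leq_add2r.
have out j : j \notin T -> (m j <= (d - 1) %/ k)%N.
  move=> jT; rewrite leq_divRL // mulnC -[X in (X * _)%N]Tk -sum_nat_const.
  by apply: leq_trans Td1; apply: leq_sum => i iT; apply: swap.
rewrite mdegE (bigID (mem T)) /= addnC; apply: leq_add => //.
have -> : (n - k = #|[pred i | i \notin T]|)%N.
  have := cardC T; rewrite card_ord Tk => e.
  by apply/eqP; rewrite -(eqn_add2l k) subnKC ?(ltnW kn) // -[X in X == _]e.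
by rewrite -sum_nat_const; apply: leq_sum => j; apply: out.
Qed.

Lemma small_sums_top : (0 < d)%N -> (0 < k)%N -> (k < n)%N ->
  exists2 m, small_sums m & mdeg m = ((n - k) * ((d - 1) %/ k) + (d - 1))%N.
Proof.
move=> d0 k0 kn; have n0 : (0 < n)%N by apply: leq_ltn_trans kn.
pose i0 := Ordinal n0; set q := ((d - 1) %/ k)%N; pose c := ((d - 1) %% k)%N.
have dqc : (d - 1 = q * k + c)%N by exact: divn_eq.
(* all exponents [q], plus the remainder at one place: any [k] of them have sum
   at most [k * q + c = d - 1] *)
exists [multinom (q + c * (i == i0))%N | i < n].
  apply/small_sumsP => T Tk; under eq_bigr do rewrite mnmE.
  rewrite big_split /= sum_nat_const.
  have dE : d = (k * q + c).+1 by rewrite mulnC -dqc subn1 prednK.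
  rewrite [X in (_ < X)%N]dE ltnS; apply: leq_add; first by rewrite leq_mul2r Tk orbT.
  rewrite big_mkcond (bigD1 i0) //= big1 ?addn0; last first.
    by move=> i /negPf->; rewrite muln0 if_same.
  by case: ifP; rewrite ?eqxx ?muln1.
rewrite mdegE; under eq_bigr do rewrite mnmE.
rewrite big_split /= sum_nat_const card_ord (bigD1 i0) //= big1 ?addn0.
  rewrite muln1 dqc mulnBl mulnC [(q * k)%N]mulnC [(q * n)%N]mulnC.
  by rewrite addnA subnK // leq_mul2r (ltnW kn) orbT.
by move=> i /negPf->; rewrite muln0.
Qed.

End BoundedSupport.

Local Close Scope ring_scope.

Theorem theorem5p4 (K : fieldType) (n d k : nat)
    (hk1 : 1 < k) (hkn : k < n) (hd : 2 <= d) :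
  quotient_regularity (@bounded_support_ideal K n d k)
    ((n - k) * ((d - 1) %/ k) + (d - 1)).
Proof.
have k0 : 0 < k := ltnW hk1.
have [m sm dm] := small_sums_top (ltnW hd) k0 hkn.
apply: eq_quotient_regularity => [f|].
  by apply: iff_sym; apply: bounded_support_idealE.
apply: artinian_monomial_regularity sm dm.
  by move=> a b; apply: small_sums_down.
by move=> a; apply: small_sums_deg.
Qed.
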